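(* Let $v,w\in W^P$ with corresponding Maya diagrams $M^v,M^w$, and put $v_0:=v$. Let $$\mathcal C:\ M^{v_0}\xrightarrow{\ \mathcal C^{(a_0,b_0)}_{(v_0,w)}\ }M^{v_1}\xrightarrow{\ \mathcal C^{(a_1,b_1)}_{(v_1,w)}\ }M^{v_2}\longrightarrow\cdots\xrightarrow{\ \mathcal C^{(a_{r-1},b_{r-1})}_{(v_{r-1},w)}\ }M^{v_r}$$ be a chain in $W^P$ in terms of Maya diagrams (as defined in the context), where $M^{v_j}\not\ge M^w$ for $1\le j\le r-1$ and $M^{v_r}\ge M^w$. Then $$(\deg_1(v,w),\dots,\deg_k(v,w))=\sum_{j=0}^{r-1}\deg \mathcal C^{(a_j,b_j)}_{(v_j,w)}.$$
   Context: **Setting.** Fix integers $0=i_0<i_1<\cdots<i_k<i_{k+1}=n$. Let $W=S_n$, written in one-line notation; $s_{e_l-e_m}$ ($l<m$) is the transposition $(l\,m)$, so $ws_{e_l-e_m}$ is obtained from $w$ by interchanging the entries in positions $l$ and $m$. Let $s_l=s_{e_l-e_{l+1}}$ and $W_P=\langle s_l: l\notin\{i_1,\dots,i_k\}\rangle$. $W^P$ is the set of minimal length representatives of $W/W_P$, i.e. permutations $w$ with $w(i_{j-1}+1)<\cdots<w(i_j)$ for $1\le j\le k+1$. It carries the Bruhat order $\le$. **Chains and degrees.** Unequal $u,u'\in W^P$ are adjacent if $u'W_P=us_{e_l-e_m}W_P$ for some reflection $s_{e_l-e_m}$, $l<m$. If $i_{a-1}+1\le l\le i_a$ and $i_{b-1}+1\le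 m\le i_b$ (necessarily $a<b$), the degree is $d(u,u')=(0^{a-1},1^{b-a},0^{k+1-b})\in\mathbb Z^k$ (exponents denote repetition). A chain from $v$ to $w$ is a sequence $u_0,\dots,u_r$ in $W^P$ with consecutive elements adjacent, $u_0\le v$ and $w\le u_r$. It originates at $u_0$ and terminates at $u_r$; its degree is $\sum_i d(u_{i-1},u_i)$. Degrees are compared componentwise. **Maya diagrams.** The Maya diagram $M^w$ of $w\in W^P$ is a grid with rows $1,\dots,k+1$ (row $1$ at the bottom) and columns $1,\dots,n$, with an $x$ in position $(y,z)$ iff $z\in\{w(1),\dots,w(i_y)\}$. Row $y$ is denoted $m_y^w$. For any such grid $M$ filled with $x$'s, $f(M,y,z)=x$ if there is an $x$ at $(y,z)$ and $f(M,y,z)=0$ otherwise; by convention $f(M,0,z)=0$. Let $S_y(M,z)=\#\{i: 1\le i\le z,\ f(M,y,i)=x\}$. Write $M^w\le M^v$ if $S_y(M^w,z)\ge S_y(M^v,z)$ for all $1\le z\le n$, $1\le y\le k+1$. Write $m_y^w\le m_y^v$ if $S_y(M^v,z)\le S_y(M^w,z)$ for all $1\le z\le n$; otherwise row $m_y^v$ is called Bruhat order incompatible with row $m_y^w$. **Generalized rim hooks.** Put $\phi(M,y)=\min\{z: f(M,y,z)=x,\ f(M,y-1,z)=0\}$ and $\psi(M,y)=\max\{z: f(M,y+1,z)=x,\ f(M,y,z)=0\}$. For $1\le a<b\le k+1$ the $(a,b)$-rim hook rule applied to $M^v$ is: set $M_{\uparrow a}=M^v$; for $j=a,a+1,\dots,b-1$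 obtain $M_{\uparrow j+1}$ from $M_{\uparrow j}$ by removing the $x$ in position $(j,\phi(M_{\uparrow j},j))$; set $M_{\downarrow b}=M_{\uparrow b}$; for $j=b-1,b-2,\dots,a$ obtain $M_{\downarrow j}$ from $M_{\downarrow j+1}$ by adding an $x$ in position $(j,\psi(M_{\downarrow j+1},j))$. The result is $M_{\downarrow a}$, which is the Maya diagram $M^{v'}$ of some $v'\in W^P$. **The steps $\mathcal C^{(a,b)}_{(v,w)}$.** Suppose (1) $m_j^v$ is Bruhat order incompatible with $m_j^w$ for $a\le j\le b-1$; (2) if $a>1$ then $m_{a-1}^w\le m_{a-1}^v$; (3) $m_b^w\le m_b^v$. Then $\mathcal C^{(a,b)}_{(v,w)}$ denotes a chain of degree at most $(0^{a-1},1^{b-a},0^{k+1-b})$ originating at $v$ and terminating at $v'$, where $M^{v'}$ is the result of applying the $(a,b)$-rim hook rule to $M^v$; one writes $M^v\xrightarrow{\mathcal C^{(a,b)}_{(v,w)}}M^{v'}$. A chain in terms of Maya diagrams is a sequence of such steps (the conditions (1)-(3) holding for $(v_j,w)$ and $(a_j,b_j)$ at each step $j$), and $\deg\mathcal C^{(a_j,b_j)}_{(v_j,w)}$ is the degree of the $j$-th step's chain. **The numbers $\deg_y(v,w)$.** Let $1\le y\le k$ and let $\pi_y:W^P\to W^{P_{i_y}}$ be the natural projection to the Grassmannian case (flag indices $0<i_y<n$), so $M^{\pi_y(v)}$ is the two-row diagram with full top row and bottom row $m_y^v$. Then $\deg_y(v,w)$ is the smallest integer $D\ge 0$ such that, starting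 from $M^{\pi_y(v)}$ and applying the $(1,2)$-rim hook rule $D$ times in the Grassmannian setting (each application removes the smallest-column $x$ of the bottom row and then adds an $x$ in the largest empty column of the bottom row), the resulting diagram is $\ge M^{\pi_y(w)}$, none of the earlier ones being so. *)

(* Defs.v *)
From HB Require Import structures.
From mathcomp Require Import all_boot all_order all_fingroup all_algebra.

Set Implicit Arguments.
Unset Strict Implicit.
Unset Printing Implicit Defensive.

Import Order.TTheory GRing.Theory Num.Theory.

(* Positions and values of permutations, and columns of diagrams, are the
   elements of 'I_n, so the 1-based position (or column) z is the ordinal of
   value z - 1.  Rows of diagrams and blocks of positions keep their 1-based
   numbering 1, ..., k+1. *)

Definition flag_indices (k n : nat) (i : nat -> nat) : Prop :=
  [/\ i 0 = 0, i k.+1 = n & forall j, j <= k -> i j < i j.+1].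

(* 1-based positions i_(j-1)+1, ..., i_j. *)
Definition in_block k n (i : nat -> nat) (j : nat) (p : 'I_n) : bool :=
  (0 < j <= k.+1) && (i j.-1 <= p < i j).

Definition in_WP k n (i : nat -> nat) (w : 'S_n) : Prop :=
  forall (j : nat) (p q : 'I_n),
    in_block k i j p -> in_block k i j q -> p < q -> w p < w q.

(* The 1-based generator s_l exchanges the ordinals l-1 and l. *)
Definition parabolic k n (i : nat -> nat) : {group 'S_n} :=
  <<[set s : 'S_n | [exists p : 'I_n, exists q : 'I_n,
       [&& q == p.+1 :> nat, val q \notin [seq i j | j <- iota 1 k]
         & s == tperm p q]]]>>%G.

Section Chains.

Variables (k n : nat) (i : nat -> nat).

(* (0^(a-1), 1^(b-a), 0^(k+1-b)); the entry of index y : 'I_k is the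
   coordinate of 1-based index y+1. *)
Definition interval_degree (a b : nat) : 'rV[int]_k :=
  \row_(y < k) ((a <= y.+1 < b : nat)%:Z)%R.

Definition degree_le (d e : 'rV[int]_k) : Prop :=
  forall y : 'I_k, (d 0 y <= e 0 y)%R.

(* [s * t] in 'S_n applies s first: the product u s_(e_l-e_m) of functions is
   [tperm l m * u], and the left coset u W_P is the MathComp right coset
   [parabolic :* u]. *)
Definition adjacent_of_degree (u u' : 'S_n) (d : 'rV[int]_k) : Prop :=
  u <> u' /\
  exists (l m : 'I_n) (a b : nat),
    [/\ l < m, in_block k i a l, in_block k i b m,
        (parabolic k n i :* u' = parabolic k n i :* (tperm l m * u))%g
      & d = interval_degree a b].

Definition chain_of_degree (x y : 'S_n) (d : 'rV[int]_k) : Prop :=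
  exists (r : nat) (u : nat -> 'S_n) (e : nat -> 'rV[int]_k),
    [/\ u 0 = x, u r = y,
        forall t, t <= r -> in_WP k i (u t),
        forall t, t < r -> adjacent_of_degree (u t) (u t.+1) (e t)
      & d = (\sum_(t < r) e t)%R].

End Chains.

(* Row y of a grid is the set of columns containing an x; only the rows
   1, ..., k+1 are meaningful. *)
Definition grid n := nat -> {set 'I_n}.

Definition maya n (i : nat -> nat) (w : 'S_n) : grid n :=
  fun y => [set w p | p : 'I_n & p < i y].

Section Grids.

Variable n : nat.
Implicit Types (M : grid n) (y : nat) (z : 'I_n).

Definition cell M y z : bool := (0 < y) && (z \in M y).

Definition count_upto M y z : nat := #|[set c : 'I_n | c <= z & cell M y c]|.

Definition row_le M M' y : bool :=
  [forall z, count_upto M' y z <= count_upto M y z].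

Definition grid_le k M M' : bool := [forall y : 'I_k.+1, row_le M M' y.+1].

(* In rim hooks the extrema below always exist; [None] is a junk value. *)
Definition phi M y : option 'I_n :=
  let P z := cell M y z && ~~ cell M y.-1 z in
  [pick z | P z && [forall z' : 'I_n, P z' ==> (z <= z')]].

Definition psi M y : option 'I_n :=
  let P z := cell M y.+1 z && ~~ cell M y z in
  [pick z | P z && [forall z' : 'I_n, P z' ==> (z' <= z)]].

Definition set_row M y (A : {set 'I_n}) : grid n :=
  fun y' => if y' == y then A else M y'.

Definition remove_x M y : grid n :=
  if phi M y is Some z then set_row M y (M y :\ z) else M.

Definition add_x M y : grid n :=
  if psi M y is Some z then set_row M y (z |: M y) else M.

Definition rim_hook (a b : nat) M : grid n :=
  foldl add_x (foldl remove_x M (iota a (b - a))) (rev (iota a (b - a))).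

(* The two-row diagram of a Grassmannian permutation. *)
Definition two_row (A : {set 'I_n}) : grid n :=
  fun y => match y with 0 => set0 | 1 => A | _ => setT end.

End Grids.

Definition maya_step k n (i : nat -> nat) (v w : 'S_n) (a b : nat) (v' : 'S_n)
    (d : 'rV[int]_k) : Prop :=
  [/\ [/\ 0 < a, a < b & b <= k.+1],
      [/\ forall j, a <= j < b -> ~~ row_le (maya i w) (maya i v) j,
          1 < a -> row_le (maya i w) (maya i v) a.-1
        & row_le (maya i w) (maya i v) b],
      forall y, 0 < y <= k.+1 -> maya i v' y = rim_hook a b (maya i v) y,
      chain_of_degree i v v' d
    & degree_le d (interval_degree k a b)].

Section GrassmannianDegree.

Variable n : nat.
Implicit Types A B : {set 'I_n}.

Let hook A := rim_hook 1 2 (two_row A) 1.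

Lemma rim_hook_two_row A : rim_hook 1 2 (two_row A) =1 two_row (hook A).
Proof.
rewrite /hook /rim_hook /= /add_x /remove_x.
case: (phi _ _) => [z|]; case: (psi _ _) => [z'|] y;
  by rewrite /set_row; case: y => [|[|y]].
Qed.

Lemma eq_cell (M M' : grid n) : M =1 M' -> forall y z, cell M y z = cell M' y z.
Proof. by move=> eqM y z; rewrite /cell eqM. Qed.

Lemma eq_remove_x (M M' : grid n) y :
  M =1 M' -> remove_x M y =1 remove_x M' y.
Proof.
move=> eqM; rewrite /remove_x.
have -> : phi M y = phi M' y.
  apply: eq_pick => z; rewrite !(eq_cell eqM); congr (_ && _).
  by apply: eq_forallb => z'; rewrite !(eq_cell eqM).
by case: (phi _ _) => [z|] // y'; rewrite /set_row !eqM.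
Qed.

Lemma eq_add_x (M M' : grid n) y : M =1 M' -> add_x M y =1 add_x M' y.
Proof.
move=> eqM; rewrite /add_x.
have -> : psi M y = psi M' y.
  apply: eq_pick => z; rewrite !(eq_cell eqM); congr (_ && _).
  by apply: eq_forallb => z'; rewrite !(eq_cell eqM).
by case: (psi _ _) => [z|] // y'; rewrite /set_row !eqM.
Qed.

Lemma eq_rim_hook a b (M M' : grid n) :
  M =1 M' -> rim_hook a b M =1 rim_hook a b M'.
Proof.
rewrite /rim_hook => eqM.
have: foldl (@remove_x n) M (iota a (b - a))
      =1 foldl (@remove_x n) M' (iota a (b - a)).
  elim: (iota _ _) M M' eqM => //= y s IH M M' eqM.
  by apply: IH; apply: eq_remove_x.
elim: (rev _) (foldl _ M _) (foldl _ M' _) => //= y s IH N N' eqN.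
by apply: IH; apply: eq_add_x.
Qed.

Lemma iter_rim_hook_two_row D A :
  iter D (rim_hook 1 2) (two_row A) =1 two_row (iter D hook A).
Proof.
elim: D => //= D IH y.
by rewrite (eq_rim_hook 1 2 IH) rim_hook_two_row.
Qed.

Lemma hookE A : A != set0 ->
  exists lo hi, [/\ lo \in A, forall c, c \in A -> lo <= c,
    hi \notin A :\ lo, forall c, c \notin A :\ lo -> c <= hi
    & hook A = hi |: (A :\ lo)].
Proof.
case/set0Pn => x0 Ax0.
case: (arg_minnP (fun z : 'I_n => val z) Ax0) => lo.
move=> Alo lo_min; have {}Alo : lo \in A by [].
have phiE : phi (two_row A) 1 = Some lo.
  rewrite /phi; case: pickP => [z|/(_ lo)] /=; rewrite /cell /= ?andbT.
    case/andP=> Az /forallP/(_ lo); rewrite /= andbT => /implyP/(_ Alo) le_z_lo.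
    by congr Some; apply/val_inj/anti_leq; rewrite le_z_lo lo_min.
  rewrite Alo /= => /negbT/negP[]; apply/forallP => c; rewrite andbT.
  by apply/implyP => /lo_min.
have Clo : lo \in ~: (A :\ lo) by rewrite !inE eqxx.
case: (arg_maxnP (fun z : 'I_n => val z) Clo) => hi.
move=> Chi' hi_max; have Chi : hi \notin A :\ lo.
  by have: hi \in ~: (A :\ lo); rewrite // inE.
have {}hi_max c : c \notin A :\ lo -> c <= hi.
  move=> Cc; apply: hi_max.
  by have: c \in ~: (A :\ lo) by rewrite inE.
exists lo, hi; split=> //.
rewrite /hook /rim_hook /= /remove_x phiE /=.
set N := set_row _ _ _.
have psiE : psi N 1 = Some hi.
  rewrite /psi; case: pickP => [z|/(_ hi)] /=; rewrite /cell /N /set_row /=.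
    rewrite in_setT /=; case/andP=> Az /forallP/(_ hi).
    rewrite /= in_setT Chi /= => le_hi_z.
    by congr Some; apply/val_inj/anti_leq; rewrite le_hi_z hi_max.
  rewrite in_setT Chi /= => /negbT/negP[]; apply/forallP => c.
  by rewrite in_setT /=; apply/implyP => /hi_max.
by rewrite /add_x psiE /set_row eqxx /N.
Qed.

Lemma count_two_row A z : count_upto (two_row A) 1 z = #|[set c in A | c <= z]|.
Proof. by apply: eq_card => c; rewrite !inE andbC. Qed.

Lemma eq_grid_le k (M1 M2 N : grid n) :
  M1 =1 M2 -> grid_le k N M1 = grid_le k N M2.
Proof.
move=> eqM; apply: eq_forallb => y; apply: eq_forallb => z.
congr (_ <= _); apply: eq_card => c; by rewrite !inE (eq_cell eqM).
Qed.

Lemma grid_le_two_row A B :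
  (forall z : 'I_n, #|[set c in A | c <= z]| <= #|[set c in B | c <= z]|) ->
  grid_le 1 (two_row B) (two_row A).
Proof.
move=> leAB; apply/forallP => -[[|[|//]] ltm]; apply/forallP => z /=.
  by rewrite !count_two_row leAB.
apply: subset_leq_card; apply/subsetP => c.
by rewrite !inE /cell /= !inE.
Qed.

Lemma grid_le_upper A B (lo : 'I_n) : #|A| = #|B| ->
  (forall c, (c \in A) = (lo <= c)) -> grid_le 1 (two_row B) (two_row A).
Proof.
move=> cardAB memA; apply: grid_le_two_row => z.
have [lt_z|le_lo] := ltnP z lo.
  rewrite eq_card0 // => c; rewrite !inE memA.
  by apply/negbTE/negP => /andP[/leq_trans le_c /le_c]; rewrite leqNgt lt_z.
have cardE (C : {set 'I_n}) : #|[set c in C | c <= z]| + #|[set c in C | z < c]| = #|C|.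
  rewrite -(cardsID [set c : 'I_n | c <= z] C); congr (_ + _).
    by apply: eq_card => c; rewrite !inE.
  by apply: eq_card => c; rewrite !inE -ltnNge andbC.
rewrite -(leq_add2r #|[set c in A | z < c]|) cardE cardAB -(cardE B) leq_add2l.
apply: subset_leq_card; apply/subsetP => c; rewrite !inE memA => /andP[_ lt_z].
by rewrite lt_z (leq_trans le_lo (ltnW lt_z)).
Qed.

Lemma two_row_reach A B : #|A| = #|B| ->
  exists D, grid_le 1 (two_row B) (iter D (rim_hook 1 2) (two_row A)).
Proof.
move=> cardAB.
suff [D leD] : exists D, grid_le 1 (two_row B) (two_row (iter D hook A)).
  by exists D; rewrite (eq_grid_le _ _ (iter_rim_hook_two_row D A)).
have [m] := ubnP (n * n - \sum_(c in A) c).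
elim: m A cardAB => // m IH A cardAB le_m.
have [A0|] := eqVneq A set0.
  exists 0; apply: grid_le_two_row => z.
  by rewrite A0 eq_card0 // => c; rewrite !inE.
case/hookE=> lo [hi [Alo lo_min Chi hi_max hookA]].
have [eq_hi|neq_hi] := eqVneq hi lo.
  exists 0; apply: (@grid_le_upper _ _ lo) => // c.
  apply/idP/idP => [/lo_min//|le_c]; apply/negPn/negP => nAc.
  have /hi_max : c \notin A :\ lo by rewrite !inE negb_and nAc orbT.
  rewrite eq_hi => le_c_lo; case/negP: nAc.
  by have -> : c = lo by apply/val_inj/anti_leq; rewrite le_c_lo.
have lt_hi : lo < hi.
  by rewrite ltn_neqAle eq_sym (inj_eq val_inj) neq_hi hi_max // !inE eqxx.
have card_hook : #|hook A| = #|B|.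
  by rewrite hookA cardsU1 Chi -cardAB [in RHS](cardsD1 lo) Alo.
have sum_hook : \sum_(c in A) c < \sum_(c in hook A) c.
  by rewrite hookA big_setU1 //= (big_setD1 lo) //= ltn_add2r.
have sum_le : \sum_(c in hook A) c <= n * n.
  rewrite -[X in X * n]card_ord -sum_nat_const big_mkcond /=.
  by apply: leq_sum => c _; case: ifP => // _; apply: ltnW.
have [|D leD] := IH _ card_hook.
  apply: leq_trans (ltn_sub2l _ sum_hook) _; last by rewrite -ltnS.
  exact: leq_trans sum_hook sum_le.
by exists D.+1; rewrite iterSr.
Qed.

Definition grassmannian_maya (i : nat -> nat) (y : nat) (v : 'S_n) : grid n :=
  two_row (maya i v y).

Lemma grassmannian_reach i y (v w : 'S_n) :
  exists D, grid_le 1 (grassmannian_maya i y w)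
                      (iter D (rim_hook 1 2) (grassmannian_maya i y v)).
Proof.
by apply: two_row_reach; rewrite !card_imset //; apply: perm_inj.
Qed.

Definition deg i y (v w : 'S_n) : nat := ex_minn (grassmannian_reach i y v w).

End GrassmannianDegree.

(* Main.v *)
(** The number [deg_y(v, w)] is the largest excess [S_y(M^v, z) - S_y(M^w, z)]
    over all columns [z].  A rim hook moves, in each row [a <= y < b], one [x]
    from a column [lo] to a column [hi >= lo], so it lowers the count at [z] by
    one exactly when [lo <= z < hi].  Left of [lo], row [y] agrees with row
    [a-1], and from [hi] on, row [y] has the same gaps as row [b]; as rows [a-1]
    and [b] are compatible with [w], every column with positive excess has
    [lo <= z < hi], and the largest excess drops by exactly one.  Finally a chain
    whose degree vanishes in coordinate [y] cannot change row [y], which forces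
    the degree of each step to be the full [(0^(a-1), 1^(b-a), 0^(k+1-b))]. *)
Require Import Defs.
From mathcomp Require Import all_boot all_order all_fingroup all_algebra.
From mathcomp Require Import zify.

Set Implicit Arguments.
Unset Strict Implicit.
Unset Printing Implicit Defensive.

Import Order.TTheory GRing.Theory Num.Theory.

(** * Counts of entries up to a column, and the excess criterion in the Grassmannian case *)

Section Counting.

Variable n : nat.
Implicit Types (A B C : {set 'I_n}) (M : grid n) (z c lo hi : 'I_n).

Definition count_le A z : nat := #|[set c in A | c <= z]|.

Lemma count_uptoE M y z : 0 < y -> count_upto M y z = count_le (M y) z.
Proof. by move=> y0; apply: eq_card => c; rewrite !inE /cell y0 andbC. Qed.

Lemma count_leS A B z :
  (forall c, c <= z -> c \in A -> c \in B) -> count_le A z <= count_le B z.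
Proof.
move=> sAB; apply/subset_leq_card/subsetP => c; rewrite !inE.
by case/andP=> Ac le_cz; rewrite le_cz sAB.
Qed.

Lemma count_le_card A z : count_le A z <= #|A|.
Proof. by apply/subset_leq_card/subsetP => c; rewrite inE => /andP[]. Qed.

Lemma count_le_total A z : (forall c, c \in A -> c <= z) -> count_le A z = #|A|.
Proof.
move=> leA; apply: eq_card => c; rewrite inE.
by apply/andP/idP => [[]//|Ac]; split=> //; apply: leA.
Qed.

Lemma count_leD A C z :
  A \subset C -> count_le C z = count_le A z + count_le (C :\: A) z.
Proof.
move=> sAC; rewrite /count_le -(cardsID A); congr (_ + _); apply: eq_card => c.
  rewrite !inE; case Ac: (c \in A); last by rewrite andbF.
  by rewrite (subsetP sAC) // andbT.
by rewrite !inE andbA.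
Qed.

(** The side condition on [hi] allows [hi = lo], where the move is trivial. Terms are added on both
    sides to avoid truncated subtraction. *)
Lemma count_le_move A lo hi z : lo \in A -> hi \notin A :\ lo ->
  count_le (hi |: (A :\ lo)) z + (lo <= z) = count_le A z + (hi <= z).
Proof.
move=> Alo Ahi.
have cnt1 c : count_le [set c] z = (c <= z).
  rewrite /count_le; case: (boolP (c <= z)) => [le_cz|lt_zc].
    rewrite (_ : [set _ in _ | _] = [set c]) ?cards1 //.
    by apply/setP => x; rewrite !inE; case: eqP => // ->.
  by rewrite eq_card0 // => x; rewrite !inE; case: eqP => // ->; apply/negbTE.
have sub1 : [set lo] \subset A by rewrite sub1set.
have sub2 : [set hi] \subset hi |: (A :\ lo) by apply: subsetUl.
rewrite (count_leD _ sub1) (count_leD _ sub2) !cnt1 setU1K //; lia.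
Qed.

(** [A] has the most entries possible beyond [z], and both sets have the same total. *)
Lemma count_le_full_tail A B z : #|A| = #|B| ->
  (forall c, z < c -> c \in A) -> count_le A z <= count_le B z.
Proof.
move=> cAB tailA.
have part C : count_le C z + #|[set c in C | z < c]| = #|C|.
  rewrite -(cardsID [set c : 'I_n | c <= z] C); congr (_ + _);
    apply: eq_card => c; rewrite !inE //.
  by rewrite -ltnNge andbC.
have : #|[set c in B | z < c]| <= #|[set c in A | z < c]|.
  by apply/subset_leq_card/subsetP => c; rewrite !inE => /andP[_ zc]; rewrite zc tailA.
move: (part A) (part B); lia.
Qed.

Lemma grid_le_two_rowP A B :
  grid_le 1 (two_row B) (two_row A) <-> forall z, count_le A z <= count_le B z.
Proof.
split=> [/forallP/(_ ord0)/forallP leBA z|]; last exact: grid_le_two_row.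
by have := leBA z; rewrite !count_uptoE.
Qed.

(** Induction on [D]: one hook lowers the count by one for [lo <= z < hi]. At the other columns the
    bound is automatic, because [A] has no entry before its minimum [lo] and is full beyond [hi]. *)
Lemma reach_two_rowP D A B : #|A| = #|B| -> A != set0 ->
  grid_le 1 (two_row B) (iter D (rim_hook 1 2) (two_row A)) <->
  forall z, count_le A z <= count_le B z + D.
Proof.
elim: D A => [|D IH] A cAB A0.
  by rewrite grid_le_two_rowP; split=> le z; have := le z; rewrite addn0.
rewrite iterSr; set N := rim_hook 1 2 (two_row A).
(* The induction hypothesis concerns grids of the form [two_row], to which [N] is only pointwise
   equal. *)
have eqN : iter D (rim_hook 1 2) N =1 iter D (rim_hook 1 2) (two_row (N 1)).
  elim: D {IH} => [|D IH] y /=; first exact: rim_hook_two_row.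
  exact: eq_rim_hook.
rewrite (eq_grid_le _ _ eqN).
have [lo [hi [Alo lo_min Chi hi_max]]] := hookE A0; rewrite -/N => NE.
have le_lohi : lo <= hi by rewrite hi_max // !inE eqxx.
have cN : #|N 1| = #|B|.
  by rewrite NE cardsU1 Chi -cAB [in RHS](cardsD1 lo) Alo.
have N0 : N 1 != set0 by rewrite NE; apply/set0Pn; exists hi; rewrite setU11.
rewrite {}IH //; have move z := count_le_move z Alo Chi; rewrite -NE in move.
split=> le z; first by have := le z; have := move z; lia.
have := move z; have := le z.
have [lt_zlo|le_loz] := ltnP z lo.
  have : count_le A z <= count_le set0 z.
    by apply: count_leS => c le_cz /lo_min; lia.
  have := count_le_card set0 z; rewrite cards0; lia.
have [le_hiz|] := leqP hi z; last lia.
suff : count_le A z <= count_le B z by lia.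
apply: count_le_full_tail => // c lt_zc; apply/negPn/negP => nAc.
by have := hi_max c; rewrite !inE (negbTE nAc) andbF => /(_ isT); lia.
Qed.

End Counting.

(** * The effect of a generalized rim hook on each row of a nested grid *)

Section RimHooks.

Variable n : nat.
Implicit Types (M N : grid n) (z c lo hi : 'I_n).

Lemma phiP M y c : cell M y c -> ~~ cell M y.-1 c ->
  exists2 lo, phi M y = Some lo &
    [/\ cell M y lo, ~~ cell M y.-1 lo &
        forall c', cell M y c' -> ~~ cell M y.-1 c' -> lo <= c'].
Proof.
move=> My My'; rewrite /phi; case: pickP => [lo|none].
  case/andP=> /andP[Mlo Mlo'] /forallP lo_min; exists lo => //; split=> // c' Mc' Mc''.
  by have := lo_min c'; rewrite Mc' Mc''.
have Pc : cell M y c && ~~ cell M y.-1 c by rewrite My.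
case: (@arg_minnP _ c [pred x | cell M y x && ~~ cell M y.-1 x] val Pc) => lo Plo lo_min.
have := none lo; move: Plo => /= -> /= /negbT/negP[].
by apply/forallP => c'; apply/implyP/lo_min.
Qed.

Lemma psiP M y c : cell M y.+1 c -> ~~ cell M y c ->
  exists2 hi, psi M y = Some hi &
    [/\ cell M y.+1 hi, ~~ cell M y hi &
        forall c', cell M y.+1 c' -> ~~ cell M y c' -> c' <= hi].
Proof.
move=> My My'; rewrite /psi; case: pickP => [hi|none].
  case/andP=> /andP[Mhi Mhi'] /forallP hi_max; exists hi => //; split=> // c' Mc' Mc''.
  by have := hi_max c'; rewrite Mc' Mc''.
have Pc : cell M y.+1 c && ~~ cell M y c by rewrite My.
case: (@arg_maxnP _ c [pred x | cell M y.+1 x && ~~ cell M y x] val Pc) => hi Phi hi_max.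
have := none hi; move: Phi => /= -> /= /negbT/negP[].
by apply/forallP => c'; apply/implyP/hi_max.
Qed.

Lemma cell_pos M y c : 0 < y -> cell M y c = (c \in M y).
Proof. by rewrite /cell => ->. Qed.

(** The removed columns move weakly to the left as the row index grows: an entry removed from row
    [j.-1] leaves a gap below row [j], so the next removal is at or left of it. An entry of row [j]
    left of its own [lo] therefore also lies in the row below, left of that row's removed column,
    and so on down to row [a.-1]. *)
Lemma foldl_remove_x M a b t : 0 < a -> a + t <= b ->
  (forall y, a <= y < b -> M y \subset M y.+1) ->
  (exists2 c, c \in M a & ~~ cell M a.-1 c) ->
  let N := foldl (@remove_x n) M (iota a t) in
  [/\ forall y, ~~ (a <= y < a + t) -> N y = M y,
      forall y, a <= y < a + t -> exists lo,
        [/\ lo \in M y, N y = M y :\ lo &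
            forall c, c < lo -> c \in M y -> cell M a.-1 c]
    & forall y, a <= y < a + t -> N y \subset N y.+1].
Proof.
move=> a0 le_b nested [c0 Mc0 Mc0']; elim: t le_b => [|t IH] le_b.
  by split=> // y; lia.
rewrite -(addn1 t) iotaD foldl_cat /=; have {IH}[|out ins sub] := IH; first lia.
set N := foldl _ _ _ in out ins sub *; set j := a + t.
have j0 : 0 < j by lia.
have Nj : N j = M j by apply: out; lia.
(* The witness is the column just removed from row [j.-1], or the given gap [c0] when row [a] is the
   first to be treated. *)
have gap : exists2 c, c \in M j &
    ~~ cell N j.-1 c /\
    (forall c', c' < c -> cell N j.-1 c' -> cell M a.-1 c').
  have [t0|t0] := posnP t.
    rewrite /j t0 addn0; exists c0 => //.
    have eqc c : cell N a.-1 c = cell M a.-1 c by rewrite /cell out //; lia.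
    by rewrite eqc; split=> // c' _; rewrite eqc.
  have [|lo' [Mlo' Nlo' lo'_min]] := ins j.-1; first by lia.
  have sM : M j.-1 \subset M j.
    by have := nested j.-1; rewrite prednK //; apply; lia.
  exists lo'; first exact: (subsetP sM).
  rewrite cell_pos ?Nlo' ?setD11; last by lia.
  split=> // c' lt_c'; rewrite cell_pos ?Nlo'; last by lia.
  by case/setD1P=> _; apply: lo'_min.
have [c1 Mc1 [Nc1 c1_min]] := gap.
have [|lo philo [Nlo Nlo' lo_min]] := @phiP N j c1 _ Nc1.
  by rewrite cell_pos // Nj.
rewrite !cell_pos // in Nlo *; rewrite Nj in Nlo.
have le_lo : lo <= c1 by apply: lo_min => //; rewrite cell_pos ?Nj.
have stepE y : remove_x N j y = if y == j then M j :\ lo else N y.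
  by rewrite /remove_x philo /set_row; case: ifP; rewrite ?Nj.
split=> y yP.
- by rewrite stepE ifN; [apply: out | ]; lia.
- rewrite stepE; have [->|neq_y] := eqVneq y j; last by apply: ins; lia.
  exists lo; split=> // c lt_c Mc; apply: c1_min; first by lia.
  apply/negPn/negP => Nc; have := lo_min c.
  by rewrite cell_pos // Nj => /(_ Mc Nc); lia.
- rewrite !stepE; have [->|neq_y] := eqVneq y j.
    rewrite ifN; last by lia.
    rewrite out; last by lia.
    by apply: subset_trans (subD1set _ _) _; apply: nested; lia.
  have [eq_y|neq_y'] := eqVneq y.+1 j; last by apply: sub; lia.
  rewrite subsetD1 -Nj -eq_y sub /=; last by lia.
  by move: Nlo'; rewrite -eq_y cell_pos //; lia.
Qed.

(** Dual to the removals. The rows are filled from the top down, so the induction peels off the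
    lowest row [a]. The entry added to row [a.+1] lies above a gap of row [a], so the added columns
    move weakly to the right on the way down. *)
Lemma foldl_add_x N a t : 0 < a ->
  (forall y, a <= y < a + t ->
     N y \subset N y.+1 /\ exists2 c, c \in N (a + t) & c \notin N y) ->
  let K := foldl (@add_x n) N (rev (iota a t)) in
  (forall y, ~~ (a <= y < a + t) -> K y = N y) /\
  (forall y, a <= y < a + t -> exists hi,
     [/\ hi \notin N y, K y = hi |: N y &
         forall c, c \in N (a + t) -> c \notin N y -> c <= hi]).
Proof.
elim: t a => [|t IH] a a0 /= hN; first by split=> // y; lia.
rewrite rev_cons foldl_rcons.
have [//|y yP|out ins] := IH a.+1.
  by rewrite addSnnS; apply: hN; lia.
rewrite addSnnS in out ins.
set K := foldl _ _ _ in out ins *.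
have Ka : K a = N a by apply: out; lia.
have [|sN [c0 Nc0 Nc0']] := hN a; first by lia.
have gap : exists2 c, c \in K a.+1 & c \notin N a /\
    (forall c', c' \in N (a + t.+1) -> c' \notin K a.+1 -> c' <= c).
  have [t0|t0] := posnP t.
    have KE : K a.+1 = N (a + t.+1) by rewrite t0 addn1 out //; lia.
    by exists c0; rewrite ?KE //; split=> // c' ->.
  have [|hi' [Nhi' KE hi'_max]] := ins a.+1; first by lia.
  exists hi'; first by rewrite KE setU11.
  split; first by apply: contra Nhi'; apply: (subsetP sN).
  move=> c' Nc' ; rewrite KE !inE negb_or => /andP[_]; exact: hi'_max.
have [c1 Kc1 [Nc1 c1_max]] := gap.
have [||hi psihi [Khi Nhi hi_max]] := @psiP K a c1.
- by rewrite cell_pos.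
- by rewrite cell_pos // Ka.
rewrite !cell_pos // in Khi Nhi; rewrite Ka in Nhi.
have le_hi : c1 <= hi by apply: hi_max; rewrite cell_pos ?Ka.
have stepE y : add_x K a y = if y == a then hi |: N a else K y.
  by rewrite /add_x psihi /set_row; case: ifP; rewrite ?Ka.
split=> y yP; rewrite stepE.
  by rewrite ifN; [apply: out | ]; lia.
have [->|neq_y] := eqVneq y a; last by apply: ins; lia.
exists hi; split=> // c Nc Nc'.
have [Kc|Kc] := boolP (c \in K a.+1); last by have := c1_max c Nc Kc; lia.
by apply: hi_max; rewrite cell_pos ?Ka.
Qed.

(** For [a = 1] the row below is empty, as [cell M 0] is false, and the fourth clause then says that
    [lo] is the first entry of row [y]. *)
Lemma rim_hookP M a b : 0 < a -> a < b ->
  (forall y, a <= y < b -> M y \subset M y.+1) ->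
  (exists2 c, c \in M a & ~~ cell M a.-1 c) ->
  (forall y, ~~ (a <= y < b) -> rim_hook a b M y = M y) /\
  (forall y, a <= y < b -> exists lo hi,
     [/\ lo \in M y, hi \notin M y :\ lo,
         rim_hook a b M y = hi |: (M y :\ lo),
         forall c, c < lo -> c \in M y -> cell M a.-1 c
       & forall c, c \in M b -> c \notin M y :\ lo -> c <= hi]).
Proof.
move=> a0 lt_ab nested gap; rewrite /rim_hook.
have eq_b : a + (b - a) = b by lia.
have := @foldl_remove_x M a b (b - a) a0; rewrite eq_b.
case=> // out ins sub; set N := foldl _ M _ in out ins sub *.
have Nb : N b = M b by apply: out; lia.
have sMb d y : y + d = b -> a <= y -> M y \subset M b.
  elim: d y => [|d IH] y; first by rewrite addn0 => ->.
  move=> eq_yb le_ay; apply: subset_trans (nested y _) (IH _ _ _); lia.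
(* The removed column [lo] is the gap that the additions require: it lies in row [b] but no longer
   in row [y]. *)
have := @foldl_add_x N a (b - a) a0; rewrite eq_b; case=> [y yP|outK insK].
  split; first by apply: sub; lia.
  have [|lo [Mlo NE _]] := ins y; first by lia.
  exists lo; last by rewrite NE setD11.
  by rewrite Nb (subsetP (sMb (b - y) y _ _)) //; lia.
split=> y yP; first by rewrite outK ?out.
have [lo [Mlo NE lo_min]] := ins y yP; have [hi [Nhi KE hi_max]] := insK y yP.
by exists lo, hi; rewrite -NE -Nb.
Qed.

End RimHooks.

(** * Maya diagrams of permutations and the change of [deg] under a rim hook *)

Section Maya.

Variables (k n : nat) (i : nat -> nat).
Hypothesis hi : flag_indices k n i.
Implicit Types (u v w : 'S_n) (z c : 'I_n).

Lemma flag_homo x y : x <= y <= k.+1 -> i x <= i y.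
Proof.
case: hi => _ _ i_lt /andP[le_xy le_yk].
elim: y le_xy le_yk => [|y IH]; first by case: x.
rewrite leq_eqVlt => /predU1P[->//|le_xy] le_yk.
by apply: leq_trans (IH _ _) (ltnW (i_lt _ _)); lia.
Qed.

Lemma flag_lt x y : x < y <= k.+1 -> i x < i y.
Proof.
move=> /andP[lt_xy le_yk]; case: hi => _ _ i_lt.
by apply: leq_trans (i_lt x _) (flag_homo _); lia.
Qed.

Lemma maya_subset v x y : x <= y <= k.+1 -> maya i v x \subset maya i v y.
Proof.
move=> xy; apply/subsetP => _ /imsetP[p px ->]; apply: imset_f.
by move: px; rewrite !inE => px; apply: leq_trans px (flag_homo xy).
Qed.

Lemma card_maya v w y : #|maya i v y| = #|maya i w y|.
Proof. by rewrite !card_imset //; apply: perm_inj. Qed.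

Lemma maya_gap v y : 0 < y <= k.+1 ->
  exists2 c, c \in maya i v y & ~~ cell (maya i v) y.-1 c.
Proof.
move=> yk; have lt_i : i y.-1 < i y by apply: flag_lt; lia.
have lt_n : i y.-1 < n.
  by have [_ <- _] := hi; apply: leq_trans lt_i (flag_homo _); lia.
exists (v (Ordinal lt_n)); first by apply: imset_f; rewrite inE.
rewrite /cell negb_and mem_imset ?inE ?ltnn ?orbT //; exact: perm_inj.
Qed.

(** The bound of [reach_two_rowP] weakens as [D] grows, so the least number of hooks is the least
    [D] that satisfies it. *)
Lemma deg_leP v w y D : 0 < y <= k.+1 ->
  deg i y v w <= D <->
  forall z, count_le (maya i v y) z <= count_le (maya i w y) z + D.
Proof.
move=> yk; have cardE := card_maya v w y.
have v0 : maya i v y != set0.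
  by have [c vc _] := maya_gap v yk; apply/set0Pn; exists c.
rewrite /deg; case: ex_minnP => m /(reach_two_rowP _ cardE v0) reach_m m_min.
split=> [le_mD z|leD]; first by apply: leq_trans (reach_m z) _; rewrite leq_add2l.
by apply/m_min/(reach_two_rowP _ cardE v0).
Qed.

Lemma row_leP v w y : 0 < y <= k.+1 ->
  row_le (maya i w) (maya i v) y <-> deg i y v w = 0.
Proof.
move=> yk; have y0 : 0 < y by case/andP: yk.
have iff0 : deg i y v w = 0 <-> deg i y v w <= 0.
  by rewrite leqn0; split=> [->|/eqP].
rewrite iff0 deg_leP //; split=> [/forallP le z|le].
  by have := le z; rewrite !count_uptoE // addn0.
by apply/forallP => z; have := le z; rewrite !count_uptoE // addn0.
Qed.

Lemma deg_rim_hook v w v' a b y : 0 < a -> a < b -> b <= k.+1 ->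
  (1 < a -> row_le (maya i w) (maya i v) a.-1) ->
  row_le (maya i w) (maya i v) b -> ~~ row_le (maya i w) (maya i v) y ->
  maya i v' y = rim_hook a b (maya i v) y -> a <= y < b ->
  deg i y v w = (deg i y v' w).+1.
Proof.
move=> a0 lt_ab le_bk compat_a compat_b incompat rowE yP.
have yk : 0 < y <= k.+1 by lia.
have [||_ /(_ y yP)] := @rim_hookP _ (maya i v) a b a0 lt_ab.
- by move=> x xP; apply: maya_subset; lia.
- by apply: maya_gap; lia.
case=> lo [h [vlo vh]]; rewrite -rowE => hookE lo_min h_max.
have cntE z := count_le_move z vlo vh; rewrite -hookE in cntE.
have sub_b u : maya i u y \subset maya i u b by apply: maya_subset; lia.
have le_loh : lo <= h.
  by apply: h_max; rewrite ?setD11 // (subsetP (sub_b v)).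
have excess z : count_le (maya i w y) z < count_le (maya i v y) z -> lo <= z < h.
  move=> lt_z; apply/andP; split; rewrite leqNgt; apply/negP => lt_zc.
  (* Left of [lo]. For [a = 1] row [y] has no entry there. Otherwise its entries up to [z] lie in
     row [a.-1], which is compatible with [w]. *)
  - have [a1|a1] := leqP a 1.
      have : count_le (maya i v y) z <= count_le set0 z.
        apply: count_leS => c le_cz vc.
        have /lo_min/(_ vc)/andP[] : c < lo by lia.
        by lia.
      by have := count_le_card (set0 : {set 'I_n}) z; rewrite cards0; lia.
    have /forallP/(_ z) := compat_a a1; rewrite !count_uptoE; try lia.
    have : count_le (maya i v y) z <= count_le (maya i v a.-1) z.
      apply: count_leS => c le_cz vc.
      by have /lo_min/(_ vc)/andP[] : c < lo by lia.
    have : count_le (maya i w a.-1) z <= count_le (maya i w y) z.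
      by apply: count_leS => c _; apply/subsetP/maya_subset; lia.
    lia.
  (* From [h] on. All columns of row [b] missing from row [y] of [v] are already counted at [z]; [w]
     has equally many in total, hence at most as many up to [z]. Subtracting them from the
     compatibility of row [b] leaves no excess in row [y]. *)
  - have /forallP/(_ z) := compat_b; rewrite !count_uptoE; try lia.
    rewrite (count_leD _ (sub_b v)) (count_leD _ (sub_b w)).
    rewrite [count_le (maya i v b :\: _) z]count_le_total; last first.
      move=> c /setDP[vc nvc]; have := h_max c vc.
      by rewrite !inE (negbTE nvc) andbF => /(_ isT); lia.
    have -> : #|maya i v b :\: maya i v y| = #|maya i w b :\: maya i w y|.
      by rewrite !cardsD !(setIidPr (sub_b _)) !(card_maya v w).
    have := count_le_card (maya i w b :\: maya i w y) z; lia.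
(* Comparing all upper bounds determines the degree up to the truncation at zero, which
   incompatibility of row [y] excludes. *)
have deg_step D : deg i y v w <= D.+1 <-> deg i y v' w <= D.
  rewrite !deg_leP //; split=> le z; have := le z; have := cntE z; last lia.
  have [/excess|] := ltnP (count_le (maya i w y) z) (count_le (maya i v y) z); lia.
have : deg i y v w <> 0 by move/(row_leP v w yk); apply/negP.
case E: (deg i y v w) => [//|m] _; congr _.+1; apply/eqP; rewrite eqn_leq.
rewrite [X in _ && X](_ : _ = true) ?andbT; last by apply/deg_step; rewrite E.
by have /deg_step := leqnn (deg i y v' w); rewrite E ltnS.
Qed.

Lemma deg_row v w v' y : 0 < y <= k.+1 ->
  maya i v y = maya i v' y -> deg i y v w = deg i y v' w.
Proof.
move=> yk eqv; have le D : deg i y v w <= D <-> deg i y v' w <= D.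
  by rewrite !deg_leP // eqv.
by apply/eqP; rewrite eqn_leq; apply/andP; split; apply/le.
Qed.

(** * Rows left unchanged by a chain, and the degree of a single step *)

Lemma parabolic_stable y (s : 'S_n) p : 0 < y <= k ->
  s \in parabolic k n i -> (s p < i y) = (p < i y).
Proof.
move=> yk; case/gen_prodgP => m [g gP ->].
elim: m g gP p => [|m IH] g gP p; first by rewrite big_ord0 perm1.
rewrite big_ord_recl permM IH => [|j]; last exact: gP.
have := gP ord0; rewrite inE => /existsP[p1 /existsP[q1 /and3P[/eqP q1E ni /eqP ->]]].
(* Exchanging the positions [q1 - 1] and [q1] crosses the boundary [i y] only when [q1 = i y]. *)
have neq : q1 != i y :> nat.
  apply: contra ni => /eqP q1i; apply/mapP; exists y; last exact: q1i.
  by rewrite mem_iota; lia.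
by case: tpermP => [->|->|]; lia.
Qed.

(** A zero coordinate puts [l] and [m] on the same side of the boundary [i y.+1]. Both the
    transposition and the parabolic factor then preserve the positions below it, so the set of their
    values is unchanged. *)
Lemma adjacent_row u u' e (y : 'I_k) : adjacent_of_degree i u u' e ->
  e 0%R y = 0%R -> maya i u' y.+1 = maya i u y.+1.
Proof.
case=> _ [l [m [a [b [lt_lm lB mB cosetE ->]]]]]; rewrite mxE => e0.
have /rcosetP[s sP ->] : u' \in (parabolic k n i :* (tperm l m * u))%g.
  by rewrite -cosetE; apply: rcoset_refl.
have yk : 0 < y.+1 <= k by have := ltn_ord y; lia.
have nab : ~~ (a <= y.+1 < b) by apply/negP => ab; move: e0; rewrite ab.
have lmE : (l < i y.+1) = (m < i y.+1).
  move: lB mB; rewrite /in_block => /andP[ak /andP[al la]] /andP[bk /andP[bm mb]].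
  have [le_a|lt_a] := leqP a y.+1.
    have le_b : b <= y.+1 by move: nab; rewrite le_a /= -leqNgt.
    have : i b <= i y.+1 by apply: flag_homo; lia.
    lia.
  have : i y.+1 <= i a.-1 by apply: flag_homo; lia.
  lia.
have stable p : ((s * tperm l m)%g p < i y.+1) = (p < i y.+1).
  rewrite permM -(parabolic_stable p yk sP).
  by case: tpermP => [->|->|].
apply/setP => c; apply/imsetP/imsetP => -[p]; rewrite inE => py ->.
  by exists ((s * tperm l m)%g p); rewrite ?inE ?stable // -permM mulgA.
exists ((s * tperm l m)^-1%g p); first by rewrite inE -stable permKV.
by rewrite mulgA permM permKV.
Qed.

Lemma adjacent_ge0 u u' e (y : 'I_k) :
  adjacent_of_degree i u u' e -> (0 <= e 0 y)%R.
Proof. by case=> _ [l [m [a [b [_ _ _ _ ->]]]]]; rewrite mxE. Qed.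

Lemma chain_degree_ge0 u u' d (y : 'I_k) :
  chain_of_degree i u u' d -> (0 <= d 0 y)%R.
Proof.
case=> r [us [e [_ _ _ adj ->]]]; rewrite summxE; apply: sumr_ge0 => t _.
exact: adjacent_ge0 (adj t (ltn_ord t)).
Qed.

(** Degrees of adjacent pairs are nonnegative, so a vanishing sum makes every link vanish in
    coordinate [y]. *)
Lemma chain_row u u' d (y : 'I_k) : chain_of_degree i u u' d ->
  d 0%R y = 0%R -> maya i u' y.+1 = maya i u y.+1.
Proof.
case=> r [us [e [<- <- _ adj ->]]]; rewrite summxE => /eqP.
rewrite psumr_eq0 => [/allP e0|t _]; last exact: adjacent_ge0 (adj t (ltn_ord t)).
have {}e0 t : t < r -> e t 0%R y = 0%R.
  by move=> lt_tr; apply/eqP/(e0 (Ordinal lt_tr)); rewrite mem_index_enum.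
elim: r adj e0 => // r IH adj e0.
rewrite (adjacent_row (adj r _) (e0 r _)) //; apply: IH => t lt_tr.
  by apply: adj; lia.
by apply: e0; lia.
Qed.

Lemma deg_maya_step v w a b v' d (y : 'I_k) : maya_step i v w a b v' d ->
  ((deg i y.+1 v w)%:Z = d 0 y + (deg i y.+1 v' w)%:Z)%R.
Proof.
case=> [[a0 lt_ab le_bk] [incompat compat_a compat_b] rows chain le_d].
have d_ge0 := chain_degree_ge0 y chain; have := le_d y; rewrite mxE => d_le.
have yk : 0 < y.+1 <= k.+1 by have := ltn_ord y; lia.
have [yP|yP] := boolP (a <= y.+1 < b).
  have degE := deg_rim_hook a0 lt_ab le_bk compat_a compat_b (incompat _ yP)
                 (rows _ yk) yP.
  suff -> : d 0%R y = 1%R by rewrite degE -add1n PoszD.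
  (* A zero here would leave the row, and hence its [deg], unchanged, contrary to the drop by one in
     [degE]. *)
  have : d 0%R y <> 0%R.
    by move=> /(chain_row chain) /esym/(deg_row w yk); rewrite degE; lia.
  by move: d_le; rewrite yP; lia.
have -> : d 0%R y = 0%R by move: d_le; rewrite (negbTE yP); lia.
rewrite add0r; congr Posz; apply: deg_row => //; rewrite rows //.
have [||out _] := @rim_hookP _ (maya i v) a b a0 lt_ab; last by rewrite out.
- by move=> x xP; apply: maya_subset; lia.
- by apply: maya_gap; lia.
Qed.

End Maya.

Theorem theorem6p1 (k n : nat) (i : nat -> nat) (hi : flag_indices k n i)
    (v w : 'S_n) (hv : in_WP k i v) (hw : in_WP k i w)
    (r : nat) (vs : nat -> 'S_n) (a b : nat -> nat) (d : nat -> 'rV[int]_k)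
    (vs0 : vs 0 = v)
    (vsWP : forall j, j <= r -> in_WP k i (vs j))
    (steps : forall j, j < r -> maya_step i (vs j) w (a j) (b j) (vs j.+1) (d j))
    (before : forall j, 0 < j < r -> ~~ grid_le k (maya i w) (maya i (vs j)))
    (final : grid_le k (maya i w) (maya i (vs r))) :
  (\row_(y < k) (deg i y.+1 v w)%:Z = \sum_(j < r) d j)%R.
Proof.
apply/rowP => y; rewrite mxE summxE -{}vs0 {before hv vsWP}.
have yk : 0 < y.+1 <= k.+1 by have := ltn_ord y; lia.
have deg_final : deg i y.+1 (vs r) w = 0.
  apply/(row_leP hi) => //; move/forallP/(_ (Ordinal (leqW (ltn_ord y)))): final.
  by [].
(* Keeping the degree that remains at [vs r] makes the claim hold for every initial segment, so it
   telescopes by induction on [r]. *)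
suff -> : ((deg i y.+1 (vs 0) w)%:Z
           = \sum_(j < r) d j 0 y + (deg i y.+1 (vs r) w)%:Z)%R.
  by rewrite deg_final addr0.
elim: r steps {deg_final final} => [|r IH] steps; first by rewrite big_ord0 add0r.
rewrite big_ord_recr /= -addrA -(deg_maya_step hi y (steps r _)) //.
by apply: IH => j lt_jr; apply: steps; lia.
Qed.
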